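(* Adopt the max-arm structure with scalar identifying scores $h_a$, and suppose the standing model conditions and the max-arm perturbation conditions hold. Let $P\in\mathcal P$ and suppose there is a set $\mathcal X_0\subseteq\mathcal X$ with $P_X(\mathcal X_0)>0$ such that for each $x\in\mathcal X_0$: (i) there is a unique active arm $a^*=a^*(x)$, i.e. $g(x,a^*,u_{P,a^*}(x))>g(x,a,u_{P,a}(x))$ for $a\ne a^*$; (ii) there is a nondegenerate convex set $J(x)\subseteq\mathcal U_0$ such that for every $m\in J(x)$, $\delta_m:=\{m-u_{P,a^*}(x)\}e_{a^*}\in D_x$, and the mean-shifting law $Q_{x,\delta_m}$ changes only the arm-$a^*$ mean, preserving every other arm mean, the remaining primary components, and $\kappa(P)(x)$; and the model is closed under conditional mixtures of these mean-shifted laws; (iii) $g(x,a^*(x),\cdot)$ is continuously differentiable and fails to be affine on $J(x)$. Then $\mathcal F_{\mathrm B}=\varnothing$, and consequently the estimator class $\mathcal T_{\mathrm{RL}}(\Psi;\eta,\kappa,\mathcal W_{\mathrm{aux}})$ is empty.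
   Context: General framework. $\mathcal X,\mathcal W$ are Polish spaces and $\mathcal P$ is a fixed class of Borel probability measures on $\mathcal X\times\mathcal W$. For $P\in\mathcal P$, $P_X$ is the marginal on $\mathcal X$ and $Q_x^P$ the regular conditional law of $W$ given $X=x$. The target is $\Psi(P)=E_{P_X}[\psi(X,u_P(X))]$ with $\psi$, $u_P$ measurable, $\psi(\cdot,u_P(\cdot))\in L^1(P_X)$, and $u_P(x)=u_{\mathrm{loc}}(x,Q_x^P)$ for one rule $u_{\mathrm{loc}}$. A nuisance declaration consists of measurable maps $\eta_j(P):\mathcal X\to\mathcal N_{0,j}$ ($j\le d$; $\mathcal N_0=\prod_j\mathcal N_{0,j}$; the primary components), $\kappa(P):\mathcal X\to\mathcal K_0$ with $\kappa(P)(x)=\kappa_\flat(x,\eta(P)(x))$ for a measurable $\kappa_\flat$, and a Polish space $\mathcal W_{\mathrm{aux}}$. The class $\mathcal F_{\mathrm B}$ consists of all measurable $f:\mathcal X\times\mathcal W\times\mathcal N_0\times\mathcal K_0\times\mathcal W_{\mathrm{aux}}\to\mathbb R$ such that for all $P,P'\in\mathcal P$ and measurable $w:\mathcal X\to\mathcal W_{\mathrm{aux}}$: if for some $j$, $\eta_l(P')=\eta_l(P)$ $P_X$-a.s. for all $l\ne j$, then $f(X,W,\eta(P')(X),\kappa(P)(X),w(X))\in L^1(P)$ with $P$-expectation $\Psi(P)$. The class $\mathcal T_{\mathrm{RL}}(\Psi;\eta,\kappa,\mathcal W_{\mathrm{aux}})$ (relative to a fixed $\mathcal P_{\mathrm{ach}}\subseteq\mathcal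 P$) consists of estimator sequences $(T_n)$ for which there is $f\in\mathcal F_{\mathrm B}$ such that for each $P\in\mathcal P_{\mathrm{ach}}$ there is a measurable $w_{f,P}$ with $T_n=\frac1n\sum_{i\le n}f(X_i,W_i,\eta(P)(X_i),\kappa(P)(X_i),w_{f,P}(X_i))+o_P(n^{-1/2})$. Standing model conditions. Fix a Borel graph $\{(x,Q):Q\in\mathfrak K_x\}$ of admissible conditional laws with Borel maps $\eta_{\mathrm{loc}}(x,Q),\kappa_{\mathrm{loc}}(x,Q)$ on it. (a) For $P\in\mathcal P$ and $P_X(A)>0$, the law with marginal $P_X(\cdot\cap A)/P_X(A)$ and the kernel of $P$ is in $\mathcal P$, with the same $\eta,\kappa$ values as $P$ on $A$. (b) There is a finite Borel cost $C(x,Q)\ge1$ on the graph with $|\psi(x,u_{\mathrm{loc}}(x,Q))|\le C(x,Q)$ (the integrand being Borel), also controlling the moments required by the model; each $P\in\mathcal P$ has $Q_x^P\in\mathfrak K_x$ a.s. and $\int C(x,Q_x^P)dP_X<\infty$; each universally measurable selection $R_x\in\mathfrak K_x$ with $\int C(x,R_x)dP_X<\infty$ defines, with marginal $P_X$, a law in $\mathcal P$. (c) $\eta(P)(x)=\eta_{\mathrm{loc}}(x,Q_x^P)$ and $\kappa(P)(x)=\kappa_{\mathrm{loc}}(x,Q_x^P)$ for $P_X$-a.e. $x$, and likewise for the integrand. Selections of non-integrable cost are localized: they are used on $\{C\le m\}$ and replaced by the baseline kernel elsewhere. Max-arm structure. $\mathcal A$ is a finite set, $\mathcal W=\mathcal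 A\times\widetilde{\mathcal W}$, $W=(A,\widetilde W)$, $Q_x^P(da,d\widetilde w)=\pi_a^P(x)Q_{x,a}^P(d\widetilde w)$ with all $\pi_a^P(x)>0$; $u_P(x)=(u_{P,a}(x))_{a\in\mathcal A}$ with $u_{P,a}(x)\in\mathcal U_0\subseteq\mathbb R$; $\psi(x,u)=\max_{a}g(x,a,u_a)$ with $g$ measurable and smooth in $u_a$. Declaration: $d=2$, $\eta_1(P)=(u_{P,a})_a$, $\eta_2(P)=\pi^P$ (in the open simplex), $\kappa(P)(x)=\mathcal A^*(x;P)=\arg\max_a g(x,a,u_{P,a}(x))$, $\mathcal K_0$ the nonempty subsets of $\mathcal A$. Identifying scores are measurable $h_a$ with $u_{P,a}(x)=E_{Q_{x,a}^P}[h_a(\widetilde W)]$ for all $P,x,a$. Max-arm perturbation conditions. For every $P\in\mathcal P$ and $P_X$-a.e. $x$: (X1) For every $a$, holding $\pi^P(x)$ and the other arm laws fixed, for every $\epsilon\in(0,1)$ and every finitely supported probability $\nu$ on $\mathrm{supp}\,Q_{x,a}^P$ with $E_\nu[h_a]=u_{P,a}(x)$, the admissible arm-$a$ laws contain $(1-\epsilon)Q_{x,a}^P+\epsilon\nu$. The resulting correspondence has Borel graph and finite cost $C$; selections with integrable cost glue to a law in $\mathcal P$ with the same $P_X,\eta,\kappa$ (others are cost-localized). (X2) There are a Borel-graph correspondence $x\mapsto D_x\subseteq\mathbb R^{|\mathcal A|}$ with $0\in D_x$ and a measurable correspondence $\mathcal R_P(x)\subseteq\mathcal A\setminus\mathcal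 A^*(x;P)$ such that for $a\in\mathcal R_P(x)$, $t e_a\in D_x$ for all sufficiently small $t$ that leave $a$ inactive. Moreover $D_x$ contains a jointly measurable path $r_x(t)$, $|t|<\epsilon_P(x)$, with $\epsilon_P:\mathcal X\to(0,\infty)$ measurable, whose inactive coordinates are zero and which satisfies $g(x,a,u_{P,a}(x)+r_{x,a}(t))=g(x,a,u_{P,a}(x))+t$ for $a\in\mathcal A^*(x;P)$. (X3) For every $\delta\in D_x$ there is a (mean-shifting) law $Q_{x,\delta}\ll Q_x^P$ on $\mathcal A\times\widetilde{\mathcal W}$ with arm probabilities $\pi^P(x)$ and arm score means $u_P(x)+\delta$, with $Q_{x,0}=Q_x^P$. The perturbation changes only $\eta_1$ and preserves $\eta_2$ and $\kappa$. The correspondence of these laws has Borel graph and finite cost $C$; every universally measurable selection $x\mapsto Q_{x,\delta(x)}$ with integrable cost glues to a law in $\mathcal P$ with marginal $P_X$ (direction $0$ is used outside each cost-localized set). *)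

(* Defs.v *)
From HB Require Import structures.
From mathcomp Require Import all_boot all_order all_algebra.
From mathcomp Require Import all_classical all_reals all_analysis.
Import Order.TTheory GRing.Theory Num.Theory.
Import numFieldNormedType.Exports.

Set Implicit Arguments.
Unset Strict Implicit.
Unset Printing Implicit Defensive.

Local Open Scope classical_set_scope.
Local Open Scope ring_scope.

(* [completePseudoMetricType] does not include separation, so Hausdorffness is
   what turns the complete pseudometric into a complete metric. *)
Definition polish (R : realType) (T : completePseudoMetricType R) :=
  hausdorff_space T /\ @second_countable T.

Notation borel T := (g_sigma_algebraType (@open T)).

(* [measurableType]s are pointed, hence a finite type must be pointed to carry
   its discrete sigma-algebra. *)
#[short(type="pointedFinType")]
HB.structure Definition PointedFinite := {T of Finite T & Pointed T}.

HB.instance Definition _ (A : finType) := isPointed.Build {set A} (@finset.set0 A).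

Notation discrete_space T := (g_sigma_algebraType (@setT (set T))).

(* R^A with its Borel sigma-algebra, generated by the coordinates *)
Definition cylinders (R : realType) (A : Type) : set (set (A -> R)) :=
  [set E | exists (a : A) (B : set R), measurable B /\ E = [set u | B (u a)]].

Notation vect R A := (g_sigma_algebraType (@cylinders R A)).

(* measurability for the trace sigma-algebra of D, which need not be measurable
   (the library's [measurable_fun D] is vacuous when D is not) *)
Definition trace_measurable_fun d1 d2 (S : measurableType d1)
    (T : measurableType d2) (D : set S) (f : S -> T) :=
  forall B, measurable B ->
    exists2 C, measurable C & D `&` f @^-1` B = D `&` C.

Definition universally_measurable_fun (R : realType) d1 d2
    (S : measurableType d1) (T : measurableType d2) (f : S -> T) :=
  forall (mu : probability S R) (B : set T), measurable B ->
    exists C1 C2 : set S, [/\ measurable C1, measurable C2,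
      C1 `<=` f @^-1` B, f @^-1` B `<=` C2 & mu (C2 `\` C1) = 0%E].

(* Measures are functions on all sets, with irrelevant values on
   non-measurable ones, so laws are compared on measurable sets only. *)
Definition same_law (R : realType) d (T : measurableType d)
    (m1 m2 : set T -> \bar R) :=
  forall B, measurable B -> m1 B = m2 B.

Section marginal.
Context (R : realType) d1 d2 (X : measurableType d1) (W : measurableType d2).

Definition proj1_fun (z : X * W) : X := z.1.

HB.instance Definition _ :=
  @isMeasurableFun.Build _ _ _ _ proj1_fun measurable_fst.

Definition marginal (P : probability (X * W)%type R) : probability X R :=
  distribution P proj1_fun.

(* Kernels are measurable maps into [pprobability], whose sigma-algebra is
   generated by the evaluations (for Polish W: by the weak topology). *)
Definition is_regular_conditional_law (P : probability (X * W)%type R)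
    (Q : X -> pprobability W R) :=
  measurable_fun setT Q /\
  forall B1 B2, measurable B1 -> measurable B2 ->
    P (B1 `*` B2) = (\int[marginal P]_(x in B1) Q x B2)%E.

End marginal.

Definition mixture (R : realType) d (T : measurableType d) (l : R)
    (m1 m2 m : set T -> \bar R) :=
  forall B, measurable B -> (m B = l%:E * m1 B + (1 - l)%:E * m2 B)%E.

Definition msupport (R : realType) (T : completePseudoMetricType R)
    (mu : set (borel T) -> \bar R) : set T :=
  [set y | forall U : set T, open U -> U y -> (0 < mu U)%E].

(* smooth on a possibly non-open set: restriction of a C^infty function on an
   open neighbourhood *)
Definition smooth_on (R : realType) (U : set R) (f : R -> R) :=
  exists (O : set R) (F : R -> R), [/\ open O, U `<=` O,
    (forall u, U u -> F u = f u) &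
    forall n u, O u -> derivable (derive1n n F) u 1].

Definition C1_on (R : realType) (J : set R) (f : R -> R) :=
  exists f' : R -> R, {within J, continuous f'} /\
    forall m, J m ->
      (fun y => (f y - f m) / (y - m)) @ within (J `\ m) (nbhs m) --> f' m.

Definition affine_on (R : realType) (J : set R) (f : R -> R) :=
  exists al be : R, forall m, J m -> f m = al * m + be.

Section arms.
Context (R : realType) (A : pointedFinType) (TW : completePseudoMetricType R).

Local Notation W := (discrete_space A * borel TW)%type.
Local Notation law := (pprobability W R).

Definition arm (a : A) (B : set (borel TW)) : set W := [set a] `*` B.

Definition arm_prob (Q : law) (a : A) : R := fine (Q (arm a setT)).

(* conditional law of W~ given A = a; the zero measure if the arm has
   probability 0 *)
Definition arm_law (Q : law) (a : A) (B : set (borel TW)) : \bar R :=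
  ((arm_prob Q a)^-1%:E * Q (arm a B))%E.

Lemma measurable_arm a (B : set (borel TW)) :
  measurable B -> measurable (arm a B).
Proof. by move=> mB; apply: measurableX => //; exact: sub_sigma_algebra. Qed.

Section arm_law_measure.
Variables (Q : law) (a : A).

Let arm_law_c0 : 0 <= (arm_prob Q a)^-1.
Proof. by rewrite invr_ge0 fine_ge0. Qed.

Let arm_law0 : arm_law Q a set0 = 0%E.
Proof. by rewrite /arm_law /arm setX0 measure0 mule0. Qed.

Let arm_law_ge0 B : (0 <= arm_law Q a B)%E.
Proof. by rewrite /arm_law mule_ge0 ?lee_fin. Qed.

Let arm_law_sigma_additive : semi_sigma_additive (arm_law Q a).
Proof.
move=> F mF tF mUF; rewrite /arm_law.
have -> : arm a (\bigcup_n F n) = \bigcup_n arm a (F n).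
  by rewrite /arm setX_bigcupr.
under eq_fun do rewrite -ge0_sume_distrr//.
apply: cvgeZl => //.
apply: measure_semi_sigma_additive.
- by move=> n; exact: measurable_arm.
- apply/trivIsetP => i j _ _ ij; rewrite /arm -setXI setIid.
  by move/trivIsetP : tF => /(_ _ _ I I ij) ->; rewrite setX0.
- by apply: bigcup_measurable => n _; exact: measurable_arm.
Qed.

HB.instance Definition _ := isMeasure.Build _ _ _ (arm_law Q a)
  arm_law0 arm_law_ge0 arm_law_sigma_additive.

End arm_law_measure.

Definition has_arm_mean (Q : law) (a : A) (h : borel TW -> R) (r : R) :=
  (arm_law Q a).-integrable setT (EFin \o h) /\
  (\int[arm_law Q a]_w (h w)%:E = r%:E)%E.

End arms.

Section model.
Context (R : realType) (A : pointedFinType)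
  (TX TW : completePseudoMetricType R).

Local Notation X := (borel TX).
Local Notation W := (discrete_space A * borel TW)%type.
Local Notation law := (pprobability W R).
Local Notation joint := (probability (X * W)%type R).
Local Notation vec := (vect R A).
Local Notation K0 := (discrete_space {set A}).

Record max_arm_model := MaxArmModel {
  laws : set joint ;
  cond : joint -> X -> law ;  (* Q_x^P *)
  U0 : set R ;
  gain : X -> A -> R -> R ;                        (* g, used on U0 only *)
  u_loc : X -> law -> vec ;
  score : A -> borel TW -> R ;                     (* h_a *)
  graph : set (X * law)%type ;                     (* admissible (x, Q) *)
  cost : X * law -> R ;                            (* C, used on graph only *)
  eta1_loc : X * law -> vec ;
  eta2_loc : X * law -> vec ;
  kappa_loc : X * law -> K0 ;
  directions : joint -> set (X * vec)%type ; (* D *)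
  shifted : joint -> X -> vec -> law         (* Q_{x,d} *)
}.

Variable M : max_arm_model.

Local Notation P_X := marginal.

Implicit Types (P : joint).

Definition u_of P (x : X) : vec := u_loc M x (cond M P x).

Definition eta1 P x : vec := u_of P x.

Definition eta2 P x : vec := fun a => arm_prob (cond M P x) a.

Definition active_arms (x : X) (u : vec) : K0 :=
  [set a : A | [forall b, gain M x b (u b) <= gain M x a (u a)]]%SET.

Definition kappa P x : K0 := active_arms x (u_of P x).

Definition psi (x : X) (u : vec) : R :=
  fine (\big[maxe/-oo%E]_(a : A) (gain M x a (u a))%:E).

Definition Psi P : \bar R := (\int[P_X P]_x (psi x (u_of P x))%:E)%E.

Definition open_simplex (p : vec) :=
  (forall a, 0 < p a) /\ \sum_(a : A) p a = 1.

Definition max_arm_structure :=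
  [/\ [/\ trace_measurable_fun
         [set z : X * discrete_space A * R | U0 M z.2]
         (fun z => gain M z.1.1 z.1.2 z.2 : R),
       forall x a, smooth_on (U0 M) (gain M x a) &
       forall P, laws M P -> is_regular_conditional_law P (cond M P)],
   forall P, laws M P ->
     [/\ measurable_fun setT (u_of P),
         forall x a, U0 M (u_of P x a),
         forall x a, 0 < arm_prob (cond M P x) a &
         (P_X P).-integrable setT (fun x => (psi x (u_of P x))%:E)] &
   forall xQ, graph M xQ ->
     [/\ forall a, U0 M (u_loc M xQ.1 xQ.2 a), forall a, U0 M (eta1_loc M xQ a),
         open_simplex (eta2_loc M xQ) & kappa_loc M xQ != finset.set0]].

Definition identifying_scores :=
  (forall a, measurable_fun setT (score M a)) /\
  forall P x a, laws M P ->
    has_arm_mean (cond M P x) a (score M a) (u_of P x a).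

Definition glued P (K : X -> law) P' :=
  [/\ laws M P', same_law (P_X P') (P_X P) &
      {ae P_X P, forall x, same_law (cond M P' x) (K x)}].

(* The cost lives on the graph, which a selection meets almost surely. *)
Definition total_cost P (K : X -> law) : \bar R :=
  (\int[P_X P]_(x in [set x | graph M (x, K x)]) (cost M (x, K x))%:E)%E.

Definition cost_localized P (m : nat) (K : X -> law) : X -> law :=
  fun x => if cost M (x, K x) <= m%:R then K x else cond M P x.

(* Selections of integrable cost glue to a law satisfying E; the others do so
   after localization. *)
Definition glues P (K : X -> law)
    (E : joint -> Prop) :=
  ((total_cost P K < +oo)%E -> exists P', glued P K P' /\ E P') /\
  forall m, exists P', glued P (cost_localized P m K) P' /\ E P'.

Definition selection P (G : set (X * law)%type) (K : X -> law) :=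
  universally_measurable_fun R K /\ {ae P_X P, forall x, G (x, K x)}.

Definition same_nuisance P P' :=
  {ae P_X P, forall x, [/\ eta1 P' x = eta1 P x, eta2 P' x = eta2 P x &
                          kappa P' x = kappa P x]}.

Definition restriction_condition :=
  forall P (B : set X), laws M P -> measurable B -> (0 < P_X P B)%E ->
  exists P', [/\ laws M P',
    forall B', measurable B' ->
      P_X P' B' = (P_X P (B' `&` B) / P_X P B)%E,
    {ae P_X P', forall x, same_law (cond M P' x) (cond M P x)} &
    {ae P_X P, forall x, B x -> [/\ eta1 P' x = eta1 P x,
       eta2 P' x = eta2 P x & kappa P' x = kappa P x]}].

Definition cost_condition :=
  [/\ measurable_fun (graph M) (cost M),
      measurable_fun (graph M) (fun xQ => psi xQ.1 (u_loc M xQ.1 xQ.2)),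
      forall xQ, graph M xQ ->
        1 <= cost M xQ /\ `|psi xQ.1 (u_loc M xQ.1 xQ.2)| <= cost M xQ,
      forall P, laws M P -> {ae P_X P, forall x, graph M (x, cond M P x)} /\
        (total_cost P (cond M P) < +oo)%E &
      forall P K, laws M P -> selection P (graph M) K ->
        glues P K (fun=> True)].

(* The corresponding identity for the integrand psi(x, u_P(x)) is the
   definition of u_P. *)
Definition local_nuisance_condition :=
  [/\ measurable_fun (graph M) (eta1_loc M),
      measurable_fun (graph M) (eta2_loc M),
      measurable_fun (graph M) (kappa_loc M) &
      forall P, laws M P -> {ae P_X P, forall x, let xQ := (x, cond M P x) in
        [/\ eta1 P x = eta1_loc M xQ, eta2 P x = eta2_loc M xQ &
            kappa P x = kappa_loc M xQ]}].

Definition standing_conditions :=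
  [/\ measurable (graph M), restriction_condition, cost_condition &
      local_nuisance_condition].

(* Q' is Q with the law of arm a replaced by
   (1 - e) Q_a + e nu, where nu = sum_i p_i dirac(y_i) *)
Definition contaminated (Q : law) (a : A) (e : R) (k : nat)
    (p : 'I_k -> R) (y : 'I_k -> borel TW) (Q' : law) :=
  forall (b : A) (B : set (borel TW)), measurable B ->
    Q' (arm b B) =
      if b == a then
        ((arm_prob Q a)%:E * ((1 - e)%:E * arm_law Q a B +
           e%:E * \sum_(i < k) (p i)%:E * \d_(y i) B))%E
      else Q (arm b B).

(* G is the correspondence of admissible laws in which only the law of arm a
   differs from that of P. *)
Definition condition_X1 P :=
  forall a, exists G : set (X * law)%type, [/\ measurable G,
    {ae P_X P, forall x e k (p : 'I_k -> R) (y : 'I_k -> borel TW) Q',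
      0 < e < 1 -> (forall i, 0 <= p i) -> \sum_(i < k) p i = 1 ->
      (forall i, msupport (arm_law (cond M P x) a) (y i)) ->
      \sum_(i < k) p i * score M a (y i) = u_of P x a ->
      contaminated (cond M P x) a e p y Q' -> G (x, Q')},
    {ae P_X P, forall x Q', G (x, Q') -> graph M (x, Q') /\
      forall b, arm_prob Q' b = arm_prob (cond M P x) b /\
        (b != a -> same_law (arm_law Q' b) (arm_law (cond M P x) b))} &
    forall K, selection P G K -> glues P K (same_nuisance P)].

Definition single (a : A) (t : R) : vec := fun b => if b == a then t else 0.

Definition shift (u d : vec) : vec := fun a => u a + d a.

Definition condition_X2 P :=
  [/\ measurable (directions M P),
      {ae P_X P, forall x, directions M P (x, fun=> 0)},
      exists RP : X -> {set A},
        (forall a, measurable [set x | a \in RP x]) /\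
        {ae P_X P, forall x a, a \in RP x -> a \notin kappa P x /\
          exists2 e, 0 < e & forall t, `|t| < e -> U0 M (u_of P x a + t) ->
            a \notin active_arms x (shift (u_of P x) (single a t)) ->
            directions M P (x, single a t)} &
      exists (eps : X -> R) (r : X -> R -> vec),
        [/\ measurable_fun setT eps, forall x, 0 < eps x,
            measurable_fun [set z : X * R | `|z.2| < eps z.1]
              (fun z => r z.1 z.2) &
            {ae P_X P, forall x t, `|t| < eps x ->
              [/\ directions M P (x, r x t),
                  forall a, a \notin kappa P x -> r x t a = 0 &
                  forall a, a \in kappa P x ->
                    U0 M (u_of P x a + r x t a) /\
                    gain M x a (u_of P x a + r x t a) =
                      gain M x a (u_of P x a) + t]}]].

Definition condition_X3 P :=
  [/\ {ae P_X P, forall x d, directions M P (x, d) ->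
        let Q := shifted M P x d in
        [/\ Q `<< cond M P x,
            forall a, arm_prob Q a = arm_prob (cond M P x) a,
            forall a, has_arm_mean Q a (score M a) (u_of P x a + d a),
            graph M (x, Q) &
            eta2_loc M (x, Q) = eta2 P x /\ kappa_loc M (x, Q) = kappa P x]},
      {ae P_X P, forall x, same_law (shifted M P x (fun=> 0)) (cond M P x)},
      measurable [set xQ : X * law | exists d,
        directions M P (xQ.1, d) /\ same_law xQ.2 (shifted M P xQ.1 d)] &
      (* the arm means recover d(x) from Q_{x,d(x)}, so that measurable
         selections of these laws are indexed by measurable directions *)
      forall d : X -> vec, universally_measurable_fun R d ->
        {ae P_X P, forall x, directions M P (x, d x)} ->
        glues P (fun x => shifted M P x (d x)) (fun=> True)].

Definition perturbation_conditions :=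
  forall P, laws M P ->
    [/\ condition_X1 P, condition_X2 P & condition_X3 P].

Section estimators.
Context (Taux : completePseudoMetricType R).
Local Notation Waux := (borel Taux).
Local Notation args := (X * W * (vec * vec) * K0 * Waux)%type.

(* the nuisance spaces N_{0,1} = U0^A, N_{0,2} = open simplex, K_0 = nonempty
   subsets of A, as subsets of the ambient types *)
Definition args_dom : set args :=
  [set z | let: (_, _, (u, p), k, _) := z in
    [/\ forall a, U0 M (u a), open_simplex p & k != finset.set0]].

(* f(X, W, eta(P')(X), kappa(P)(X), w(X)) *)
Definition plug_in (f : args -> R) P P' (w : X -> Waux) (z : X * W) : R :=
  f (z.1, z.2, (eta1 P' z.1, eta2 P' z.1), kappa P z.1, w z.1).

Definition F_B : set (args -> R) :=
  [set f | trace_measurable_fun args_dom f /\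
    forall P P' w, laws M P -> laws M P' -> measurable_fun setT w ->
      {ae P_X P, forall x, eta2 P' x = eta2 P x} \/
      {ae P_X P, forall x, eta1 P' x = eta1 P x} ->
      P.-integrable setT (EFin \o plug_in f P P' w) /\
      (\int[P]_z (plug_in f P P' w z)%:E = Psi P)%E].

Definition iid_sample d (Omega : measurableType d) (mu : probability Omega R)
    (P : joint) (Z : nat -> Omega -> X * W) :=
  (forall i, measurable_fun setT (Z i)) /\
  forall n (B : 'I_n -> set (X * W)%type), (forall i, measurable (B i)) ->
    mu [set om | forall i : 'I_n, B i (Z i om)] = (\prod_(i < n) P (B i))%E.

Definition estimator_sequence := forall n, n.-tuple (X * W)%type -> R.

(* T_n = n^-1 sum_(i < n) phi(Z_i) + o_P(n^-1/2) under iid sampling from P *)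
Definition asymptotically_linear P (T : estimator_sequence)
    (phi : X * W -> R) :=
  forall d (Omega : measurableType d) (mu : probability Omega R) Z,
    iid_sample mu P Z -> forall e, 0 < e ->
    (fun n => mu [set om | e <= Num.sqrt n%:R *
        `|T n [tuple Z i om | i < n] -
          n%:R^-1 * \sum_(i < n) phi (Z i om)|]) @ \oo --> 0%E.

Definition T_RL (Pach : set joint) :
    set estimator_sequence :=
  [set T | (forall n, measurable_fun setT (T n)) /\
    exists2 f, F_B f & forall P, Pach P ->
      exists2 w, measurable_fun setT w &
        asymptotically_linear P T (plug_in f P P w)].

End estimators.

End model.

Arguments F_B {R A TX TW} M Taux.
Arguments T_RL {R A TX TW} M Taux Pach.

(* Main.v *)
(* If f is in F_B and P0, P1, P2 are laws with the same covariate marginal, the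
   same arm probabilities and the same active set, then f evaluated at the
   nuisance values of P0 is unbiased for Psi at each of the three laws. When the
   kernel of P0 is the l-mixture of those of P1 and P2, the expectation of f is
   the l-mixture of the other two, hence so is Psi; applied to all conditional
   restrictions of the laws this holds pointwise for psi. Taking for P1, P2 the
   laws in which the mean of the unique active arm a is shifted to t1, t2, the
   mean of that arm under P0 is l t1 + (1 - l) t2, so g(x, a, .) satisfies the
   affine identity at t1, t2, l.

   No measurable selection is needed (J(x) is not assumed to depend measurably
   on x): as g(x, a, .) is continuous and not affine on the interval J(x), the
   affine identity fails at some rational t1, t2, l, and one of these countably
   many choices fails on a set that is not negligible. *)

Require Import Defs.
From HB Require Import structures.
From mathcomp Require Import all_boot all_order all_algebra.
From mathcomp Require Import all_classical all_reals all_analysis.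
From mathcomp Require Import measurable_realfun.
From mathcomp Require Import ring lra.
Import Order.TTheory GRing.Theory Num.Theory.
Import numFieldNormedType.Exports.

Set Implicit Arguments.
Unset Strict Implicit.
Unset Printing Implicit Defensive.

Local Open Scope classical_set_scope.
Local Open Scope ring_scope.

(** * Equality of laws on measurable sets, and integration against mixtures *)

Section mixtures.
Context (R : realType) d (T : measurableType d).
Implicit Types m : {measure set T -> \bar R}.

Lemma same_law_sym (m1 m2 : set T -> \bar R) : same_law m1 m2 -> same_law m2 m1.
Proof. by move=> m12 B mB; rewrite m12. Qed.

Lemma same_law_integral m1 m2 D (f : T -> \bar R) : same_law m1 m2 ->
  (\int[m1]_(x in D) f x = \int[m2]_(x in D) f x)%E.
Proof. by move=> m12; apply: eq_measure_integral => B mB _; exact: m12. Qed.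

Lemma same_law_integrable m1 m2 D (f : T -> \bar R) : same_law m1 m2 ->
  m1.-integrable D f -> m2.-integrable D f.
Proof.
move=> m12 /integrableP[mf foo]; apply/integrableP; split => //.
by rewrite (same_law_integral _ _ (same_law_sym m12)).
Qed.

Lemma same_law_ae m1 m2 (Q : T -> Prop) : same_law m1 m2 ->
  {ae m1, forall x, Q x} -> {ae m2, forall x, Q x}.
Proof. by move=> m12 [N [mN N0 QN]]; exists N; split => //; rewrite -m12. Qed.

Lemma same_law_trans (m1 m2 m3 : set T -> \bar R) :
  same_law m1 m2 -> same_law m2 m3 -> same_law m1 m3.
Proof. by move=> m12 m23 B mB; rewrite m12// m23. Qed.

Lemma mixture_same_law (l : R) (m1 m1' m2 m2' m m' : set T -> \bar R) :
  same_law m1 m1' -> same_law m2 m2' -> same_law m m' ->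
  mixture l m1 m2 m -> mixture l m1' m2' m'.
Proof. by move=> m11 m22 mm mixm B mB; rewrite -m11// -m22// -mm// mixm. Qed.

Lemma ge0_integral_mixture (l : R) m1 m2 m (f : T -> \bar R) : 0 <= l <= 1 ->
  mixture l m1 m2 m -> measurable_fun setT f -> (forall x, 0 <= f x)%E ->
  (\int[m]_x f x = l%:E * \int[m1]_x f x + (1 - l)%:E * \int[m2]_x f x)%E.
Proof.
move=> /andP[l0 l1] mixm mf f0.
have l1' : 0 <= 1 - l by rewrite subr_ge0.
pose k1 := NngNum l0; pose k2 := NngNum l1'.
transitivity (\int[measure_add (mscale k1 m1) (mscale k2 m2)]_x f x)%E.
  apply: eq_measure_integral => B mB _.
  by rewrite mixm// /measure_add/= /msum/= !big_ord_recl big_ord0 /= adde0.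
rewrite ge0_integral_measure_add//.
by rewrite !ge0_integral_mscale.
Qed.

(** The nonnegative case applies to the positive and the negative part of [f]. Integrability under
    [m1] and [m2] makes the four resulting integrals finite, so they can be regrouped as real
    numbers. *)
Lemma integral_mixture (l : R) m1 m2 m (f : T -> \bar R) : 0 <= l <= 1 ->
  mixture l m1 m2 m -> m1.-integrable setT f -> m2.-integrable setT f ->
  (\int[m]_x f x = l%:E * \int[m1]_x f x + (1 - l)%:E * \int[m2]_x f x)%E.
Proof.
move=> l01 mixm f1 f2; have mf := measurable_int _ f1.
rewrite integralE !(ge0_integral_mixture l01 mixm) //;
  [|exact: measurable_funeneg|exact: measurable_funepos].
rewrite [in RHS]integralE [X in (_ = _ + _ * X)%E]integralE.
have fin m' g : m'.-integrable setT g -> (\int[m']_x g x)%E \is a fin_num.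
  exact: integrable_fin_num.
rewrite -(fineK (fin _ _ (integrable_funepos measurableT f1))).
rewrite -(fineK (fin _ _ (integrable_funeneg measurableT f1))).
rewrite -(fineK (fin _ _ (integrable_funepos measurableT f2))).
rewrite -(fineK (fin _ _ (integrable_funeneg measurableT f2))).
by rewrite -!(EFinB, EFinM, EFinD); congr (_%:E); ring.
Qed.

End mixtures.

Section mixture_law.
Context (R : realType) d (T : measurableType d) (l : {i01 R})
  (m1 m2 : probability T R).

Let l_ge0 : 0 <= l%:num. Proof. by []. Qed.
Let onem_l_ge0 : 0 <= 1 - l%:num. Proof. by rewrite subr_ge0. Qed.

(** Written as a sum of scaled measures so that the measure structure is inherited; the bundled
    bounds on [l] supply the nonnegativity of both weights. *)
Definition mixture_law : set T -> \bar R :=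
  measure_add (mscale (NngNum l_ge0) m1) (mscale (NngNum onem_l_ge0) m2).

HB.instance Definition _ := Measure.on mixture_law.

Lemma mixture_lawE (B : set T) :
  mixture_law B = (l%:num%:E * m1 B + (1 - l%:num)%:E * m2 B)%E.
Proof.
by rewrite /mixture_law /measure_add/= /msum/= !big_ord_recl big_ord0 adde0.
Qed.

Let mixture_law_setT : mixture_law setT = 1%E.
Proof.
by rewrite mixture_lawE !probability_setT !mule1 -EFinD addrC subrK.
Qed.

HB.instance Definition _ :=
  Measure_isProbability.Build _ _ _ mixture_law mixture_law_setT.

End mixture_law.

(** * Measurable kernels, and joint laws built from them *)

Section laws_of_laws.
Context (R : realType) d1 d2 (X : measurableType d1) (W : measurableType d2).
Implicit Types K : X -> pprobability W R.

Lemma measurable_fun_evaluation K B : measurable_fun setT K -> measurable B ->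
  measurable_fun setT (fun x => K x B).
Proof. by move=> mK; exact: (measurable_kernel (kprobability mK)). Qed.

Lemma measurable_fun_evaluations K :
  (forall B, measurable B -> measurable_fun setT (fun x => K x B)) ->
  measurable_fun setT K.
Proof.
move=> mK.
apply: (measurability (@pset _ _ _ : set (set (pprobability W R)))) => //.
move=> _ -[_ [r r01] [B mB <-]] <-.
by rewrite /mset; apply: emeasurable_fun_infty_o => //; exact: mK.
Qed.

Lemma measurable_fun_mixture_law (l : {i01 R}) K1 K2 :
  measurable_fun setT K1 -> measurable_fun setT K2 ->
  measurable_fun setT
    (fun x => mixture_law l (K1 x) (K2 x) : pprobability W R).
Proof.
move=> mK1 mK2; apply: measurable_fun_evaluations => B mB.
rewrite (_ : (fun x => _) =
    fun x => (l%:num%:E * K1 x B + (1 - l%:num)%:E * K2 x B)%E); last first.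
  by apply/funext => x; exact: mixture_lawE.
by apply: emeasurable_funD; apply: emeasurable_funM => //;
  exact: measurable_fun_evaluation.
Qed.

Lemma universally_measurable_fun_measurable (f : X -> W) :
  measurable_fun setT f -> universally_measurable_fun R f.
Proof.
move=> mf mu B mB; exists (f @^-1` B), (f @^-1` B).
have mfB : measurable (f @^-1` B) by rewrite -[_ @^-1` _]setTI; exact: mf.
by split => //; rewrite setDv measure0.
Qed.

(** The sets of laws closed under [same_law] form a sigma-algebra that contains the generators
    [pset], hence every section of [G]. This allows a kernel, which gluing prescribes only up to
    [same_law], to be replaced by an equivalent one inside the graph. *)
Lemma measurable_saturated (G : set (X * pprobability W R)) x
    (Q Q' : pprobability W R) :
  measurable G -> same_law Q Q' -> G (x, Q) -> G (x, Q').
Proof.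
move=> mG QQ' GQ.
pose C := [set A : set (pprobability W R) | forall Q Q' : pprobability W R,
  same_law Q Q' -> A Q -> A Q'].
have sC : sigma_algebra setT C.
  split => [//|A CA P1 P2 P12 [_ AP1]|F CF P1 P2 P12 [n _ FP1]].
    by split => // AP2; apply: AP1; apply: CA AP2; exact: same_law_sym.
  by exists n => //; exact: CF FP1.
have pC : @pset _ W R `<=` C.
  move=> _ [r _ [U mU <-]] P1 P2 P12; rewrite /mset/=.
  by rewrite P12.
have := measurable_xsection x mG; move=> mGx.
have : C (xsection G x) by apply: smallest_sub mGx.
by move=> /(_ _ _ QQ'); rewrite /xsection/= !inE; exact.
Qed.

Lemma marginal_ae (P : probability (X * W)%type R) (S : X -> Prop) :
  {ae marginal P, forall x, S x} -> {ae P, forall z, S z.1}.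
Proof.
move=> [N [mN N0 SN]]; exists (fst @^-1` N); split => //.
- by rewrite -[_ @^-1` _]setTI; exact: measurable_fst.
- by move=> z /= Sz; exact: SN.
Qed.

(** Measurable rectangles form a generating family stable under intersection, so it suffices to
    compare the laws there. On a rectangle each law is an integral of its kernel against the common
    marginal, and the kernels are mixed pointwise. *)
Lemma mixture_joint (l : {i01 R}) (P0 P1 P2 : probability (X * W)%type R)
    (Q0 Q1 Q2 : X -> pprobability W R) :
  is_regular_conditional_law P0 Q0 -> is_regular_conditional_law P1 Q1 ->
  is_regular_conditional_law P2 Q2 ->
  same_law (marginal P1) (marginal P0) ->
  same_law (marginal P2) (marginal P0) ->
  {ae marginal P0, forall x, mixture l%:num (Q1 x) (Q2 x) (Q0 x)} ->
  mixture l%:num P1 P2 P0.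
Proof.
move=> [mQ0 Q0E] [mQ1 Q1E] [mQ2 Q2E] P10 P20 mixQ B mB.
rewrite -mixture_lawE.
apply: (measure_unique [set A `*` B | A in measurable & B in measurable]
  (fun=> setT)) => //.
- exact: measurable_prod_measurableType.
- move=> _ _ [A1 mA1 [A2 mA2 <-]] [B1 mB1 [B2 mB2 <-]].
  exists (A1 `&` B1); first exact: measurableI.
  by exists (A2 `&` B2); [exact: measurableI|rewrite setXI].
- by move=> i; exists setT => //; exists setT => //; rewrite setXTT.
- by rewrite bigcup_const.
- move=> _ [A mA [C mC <-]].
  apply: (eq_trans (Q0E A C mA mC)); apply: esym.
  apply: (eq_trans (mixture_lawE _ _ _ _)).
  have -> := Q1E A C mA mC; have -> := Q2E A C mA mC.
  rewrite (same_law_integral _ _ P10) (same_law_integral _ _ P20).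
  have mQ (Q : X -> pprobability W R) D : measurable_fun setT Q ->
      measurable_fun D (fun x => Q x C).
    by move=> mq; apply: measurable_funTS; exact: measurable_fun_evaluation.
  rewrite -!ge0_integralZl//; try exact: mQ; try by rewrite lee_fin subr_ge0.
  rewrite -ge0_integralD//; last 4 first.
  + by move=> x _; rewrite mule_ge0.
  + by apply: emeasurable_funM => //; exact: mQ.
  + by move=> x _; rewrite mule_ge0// lee_fin subr_ge0.
  + by apply: emeasurable_funM => //; exact: mQ.
  apply: ae_eq_integral => //; last by apply: filterS mixQ => x -> .
    by apply: emeasurable_funD; apply: emeasurable_funM => //; exact: mQ.
  exact: mQ.
- by move=> k; rewrite (le_lt_trans (probability_le1 _ _)) ?ltry.
Qed.

End laws_of_laws.

(** * Almost everywhere arguments for integrals *)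

Section ae_integrals.
Context (R : realType) d (T : measurableType d) (mu : {measure set T -> \bar R}).

Lemma ae_eq_integrable (f g : T -> \bar R) : measurable_fun setT g ->
  {ae mu, forall x, f x = g x} -> mu.-integrable setT f ->
  mu.-integrable setT g.
Proof.
move=> mg fg /integrableP[mf foo]; apply/integrableP; split => //.
rewrite (ae_eq_integral (fun x => `|f x|)%E) //.
- exact: measurableT_comp.
- exact: measurableT_comp.
- by apply: filterS fg => x -> _.
Qed.

(** If the integral vanished, so would that of [|h|], and [h] would be both zero and positive almost
    everywhere; the whole space would then be null. *)
Lemma ae_gt0_integral_neq0 (h : T -> R) : (0 < mu setT)%E ->
  mu.-integrable setT (EFin \o h) -> {ae mu, forall x, 0 < h x} ->
  (\int[mu]_x (h x)%:E)%E <> 0%E.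
Proof.
move=> mu0 ih h0 ih0.
have mh := measurable_int _ ih.
have : (\int[mu]_x `|(h x)%:E|)%E = 0%E.
  rewrite -ih0; apply: ae_eq_integral => //; first exact: measurableT_comp.
  by apply: filterS h0 => x hx _; rewrite gee0_abs// lee_fin ltW.
move=> /(ae_eq_integral_abs mu measurableT mh) h00.
have [N [mN N0 TN]] : {ae mu, forall x, False}.
  apply: filterS2 h0 h00 => x hx /(_ I) [hx0].
  by move: hx; rewrite hx0 ltxx.
have NT : N = setT by rewrite -subTset => x _; exact: TN.
by move: mu0; rewrite -NT N0 ltxx.
Qed.

End ae_integrals.

(** * Failure of the affine identity at rational points *)

Section affine_on_rationals.
Context (R : realType).
Implicit Types (J : set R) (g : R -> R).

(** Near [m] the difference quotient is within 1 of [g' m], so its absolute value is at most [K];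
    this gives a Lipschitz bound at [m]. *)
Lemma C1_on_continuous J g (m e : R) : C1_on J g -> J m -> 0 < e ->
  exists2 del, 0 < del &
    forall y, J y -> `|y - m| < del -> `|g y - g m| < e.
Proof.
move=> [g' [_ dg]] Jm e0.
have /cvgrPdist_lt/(_ 1 ltr01) := dg m Jm.
rewrite near_withinE => /nbhs_ballP[d /= d0 dd].
pose K := `|g' m| + 1.
have K0 : 0 < K by rewrite /K ltr_wpDl.
exists (Num.min d (e / K)); first by rewrite lt_min d0 divr_gt0.
move=> y Jy; rewrite lt_min => /andP[ymd yme].
have [->|ym] := eqVneq y m; first by rewrite subrr normr0.
have ym0 : 0 < `|y - m| by rewrite normr_gt0 subr_eq0.
have slope : `|(g y - g m) / (y - m)| <= K.
  have := dd y; rewrite /ball/= distrC ymd => /(_ isT).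
  move=> /(_ (conj Jy (elimN eqP ym))) dy; rewrite /K -lerBlDl.
  by rewrite (le_trans _ (ltW dy))// distrC lerB_dist.
rewrite -[g y - g m](@divfK _ (y - m)) ?subr_eq0// normrM.
rewrite (@le_lt_trans _ _ (K * `|y - m|)) ?ler_wpM2r//.
by rewrite mulrC -ltr_pdivlMr.
Qed.

(** Two rational points of [J] are fixed first. Some point [m] of [J] lies off the chord of [g]
    through them, and by continuity a rational point close to [m] does too. Of the three rationals
    the middle one is a convex combination of the others, with a rational weight. *)
Lemma nonaffine_rational J g : @convex_set R R^o J ->
  (exists m1 m2, [/\ J m1, J m2 & m1 != m2]) -> C1_on J g ->
  ~ affine_on J g ->
  exists p r l : rat, let: l' := ratr l : R in
    [/\ 0 <= l' <= 1, J (ratr p), J (ratr r) &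
      g (l' * ratr p + (1 - l') * ratr r) <>
      l' * g (ratr p) + (1 - l') * g (ratr r)].
Proof.
move=> cJ [m1 [m2 [Jm1 Jm2 m12]]] C1g naff.
have itvJ a b c : J a -> J b -> a < c < b -> J c.
  move=> Ja Jb /andP[ac cb].
  have ab : 0 < b - a by rewrite subr_gt0 (lt_trans ac).
  have l0 : 0 <= (b - c) / (b - a) by apply: divr_ge0; lra.
  have l1 : (b - c) / (b - a) <= 1.
    by rewrite ler_pdivrMr// mul1r lerB// ltW.
  have := cJ a b (Itv01 l0 l1); rewrite !inE => /(_ Ja Jb).
  rewrite -[conv _ _ _]/((b - c) / (b - a) * a + (1 - (b - c) / (b - a)) * b).
  suff -> : (b - c) / (b - a) * a + (1 - (b - c) / (b - a)) * b = c by [].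
  by field; rewrite gt_eqF.
have [q1 [q2 [q12 Jq1 Jq2]]] : exists q1 q2 : rat,
    [/\ ratr q1 < ratr q2 :> R, J (ratr q1) & J (ratr q2)].
  wlog lt12 : m1 m2 Jm1 Jm2 m12 / m1 < m2.
    move=> wl; have [lt12|gt12] := ltP m1 m2; first exact: (wl m1 m2).
    by apply: (wl m2 m1); rewrite // 1?eq_sym// lt_neqAle eq_sym m12.
  have [q1 /[!in_itv]/= q1m] := rat_in_itvoo lt12.
  have [m1q1 q1m2] := andP q1m.
  have [q2 /[!in_itv]/= q2m] := rat_in_itvoo q1m2.
  have [q1q2 q2m2] := andP q2m.
  exists q1, q2; split => //; first exact: (itvJ m1 m2).
  by apply: (itvJ m1 m2) => //; rewrite q2m2 (lt_trans m1q1).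
(* D a b c vanishes iff the points of the graph over a, b, c are collinear. *)
pose D (a b c : R) := (c - a) * g b - (c - b) * g a - (b - a) * g c.
have violation (a b c : rat) : J (ratr a) -> J (ratr c) ->
    ratr a < ratr b :> R -> ratr b < ratr c :> R ->
    D (ratr a) (ratr b) (ratr c) != 0 ->
  exists p r l : rat, let: l' := ratr l : R in
    [/\ 0 <= l' <= 1, J (ratr p), J (ratr r) &
      g (l' * ratr p + (1 - l') * ratr r) <>
      l' * g (ratr p) + (1 - l') * g (ratr r)].
  (* The weight is the barycentric coordinate for which [l * a + (1 - l) * c = b]. *)
  move=> Ja Jc ab bc D0; exists a, c, ((c - b) / (c - a)).
  have ac : 0 < ratr c - ratr a :> R by rewrite subr_gt0 (lt_trans ab).
  rewrite fmorph_div/= !rmorphB/=.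
  set l := _ / _; have lac : l * (ratr c - ratr a) = ratr c - ratr b.
    by rewrite divfK// gt_eqF.
  split => //.
    have lE : l = 1 - (ratr b - ratr a) / (ratr c - ratr a).
      by rewrite /l; field; rewrite gt_eqF.
    apply/andP; split; first by apply: divr_ge0; lra.
    by rewrite lE gerBl; apply: divr_ge0; lra.
  have -> : l * ratr a + (1 - l) * ratr c = ratr b.
    rewrite (_ : ratr b = ratr c - l * (ratr c - ratr a)); first by ring.
    by rewrite lac; ring.
  move=> gb; move/eqP : D0; apply; rewrite /D gb -lac.
  by rewrite (_ : ratr b = ratr c - l * (ratr c - ratr a)); [ring|rewrite lac; ring].
have [p pE] : exists p : R, p = ratr q1 by exists (ratr q1).
have [r rE] : exists r : R, r = ratr q2 by exists (ratr q2).
move: q12 Jq1 Jq2; rewrite -pE -rE => pr Jp Jr.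
have [m Jm Dm] : exists2 m, J m & D p m r != 0.
  apply: contrapT => noD; apply: naff.
  (* Slope and intercept of the chord through the points over [p] and [r]. *)
  exists ((g r - g p) / (r - p)), (g p - (g r - g p) / (r - p) * p) => m Jm.
  have D0 : D p m r = 0.
    by apply: contrapT => /eqP Dm; apply: noD; exists m.
  have rp : r - p != 0 by rewrite subr_eq0 gt_eqF.
  apply: (mulfI rp).
  have -> : (r - p) * g m = (r - m) * g p + (m - p) * g r.
    by apply/eqP; rewrite -subr_eq0; apply/eqP; rewrite -[RHS]D0 /D; ring.
  by field.
have rp : 0 < r - p by rewrite subr_gt0.
(* Moving [m] by at most [e], with [g] also changing by at most [e], alters [D p m r] by at most
   [K * e]. The choice of [e] below makes this half of [|D p m r|], so [D] cannot reach 0. *)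
pose K := r - p + `|g p| + `|g r|.
have K0 : 0 < K by rewrite /K -addrA ltr_wpDr// addr_ge0.
have e0 : 0 < `|D p m r| / (2 * K).
  by rewrite divr_gt0 ?normr_gt0 ?mulr_gt0.
have [del del0 gdel] := C1_on_continuous C1g Jm e0.
have [q Jq qm] : exists2 q : rat, J (ratr q) & `|ratr q - m| <
    Num.min del (`|D p m r| / (2 * K)).
  set eta := Num.min _ _; have eta0 : 0 < eta by rewrite lt_min del0.
  have [c Jc cm] : exists2 c, J c & c != m.
    have [pm|pm] := eqVneq p m; last by exists p.
    by exists r => //; rewrite -pm gt_eqF.
  have [cm'|mc] := ltP c m.
    have : Num.max c (m - eta) < m by rewrite gt_max cm' ltrBlDr ltrDl.
    move=> /rat_in_itvoo[q]; rewrite in_itv/= gt_max => /andP[/andP[cq mq] qm].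
    exists q; first by apply: (itvJ c m); rewrite // cq.
    by rewrite ltr_norml; apply/andP; split; lra.
  have {}mc : m < c by rewrite lt_neqAle eq_sym cm.
  have : m < Num.min c (m + eta) by rewrite lt_min mc ltrDl.
  move=> /rat_in_itvoo[q]; rewrite in_itv/= lt_min => /andP[mq /andP[qc qe]].
  exists q; first by apply: (itvJ m c); rewrite // mq.
  by rewrite ltr_norml; apply/andP; split; lra.
have {}Dq : D p (ratr q) r != 0.
  move: qm; rewrite lt_min => /andP[/(gdel _ Jq) gq qm].
  have : `|D p (ratr q) r - D p m r| < `|D p m r|.
    have -> : D p (ratr q) r - D p m r = (r - p) * (g (ratr q) - g m) +
        ((ratr q - m) * g p - (ratr q - m) * g r) by rewrite /D; ring.
    set e := _ / _ in gq qm.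
    apply: (@le_lt_trans _ _ (K * e)).
      rewrite (le_trans (ler_normD _ _))// normrM (gtr0_norm rp).
      have := ler_normB ((ratr q - m) * g p) ((ratr q - m) * g r).
      rewrite !normrM => le2.
      have h1 : (r - p) * `|g (ratr q) - g m| <= (r - p) * e.
        by apply: ler_wpM2l; exact: ltW.
      have h2 : `|ratr q - m| * `|g p| <= e * `|g p|.
        by apply: ler_wpM2r => //; exact: ltW.
      have h3 : `|ratr q - m| * `|g r| <= e * `|g r|.
        by apply: ler_wpM2r => //; exact: ltW.
      have -> : K * e = (r - p) * e + (e * `|g p| + e * `|g r|).
        by rewrite /K; ring.
      exact: lerD h1 (le_trans le2 (lerD h2 h3)).
    have -> : K * e = `|D p m r| / 2 by rewrite /e; field; rewrite gt_eqF.
    by rewrite ltr_pdivrMr// ltr_pMr ?normr_gt0// ltr1n.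
  by apply: contraTneq => ->; rewrite sub0r normrN ltxx.
(* Sorting the three points changes [D] at most by a sign, and [D] vanishes when two of them
   coincide. *)
have [qp|pq|/esym qp] := ltgtP (ratr q) p.
- apply: (violation q q1 q2); rewrite -?pE -?rE //; apply: contra_neq Dq => Dq.
  by apply: oppr_inj; rewrite oppr0 -[RHS]Dq /D; ring.
- have [qr|rq|qr] := ltgtP (ratr q) r.
  + by apply: (violation q1 q q2); rewrite -?pE -?rE.
  + apply: (violation q1 q2 q); rewrite -?pE -?rE //; apply: contra_neq Dq => Dq.
    by apply: oppr_inj; rewrite oppr0 -[RHS]Dq /D; ring.
  + by move: Dq; rewrite qr /D; case/eqP; ring.
- by move: Dq; rewrite -qp /D; case/eqP; ring.
Qed.

End affine_on_rationals.

(** * Conditioning on a set of covariates *)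

Section restriction.
Context (R : realType) d (T : measurableType d) (mu nu : {measure set T -> \bar R})
  (B : set T).

(** The law [nu] is [mu] conditioned on [B]: it gives no mass to the complement of [B], nor to a
    [mu]-null set. *)
Lemma restricted_ae (S : T -> Prop) : measurable B ->
  (forall E, measurable E -> nu E = (mu (E `&` B) / mu B)%E) ->
  {ae mu, forall x, B x -> S x} -> {ae nu, forall x, S x}.
Proof.
move=> mB nuE [N [mN N0 BSN]]; exists (N `|` ~` B); split.
- by apply: measurableU => //; exact: measurableC.
- rewrite nuE; last by apply: measurableU => //; exact: measurableC.
  rewrite setIUl setICl setU0 (_ : mu (N `&` B) = 0%E) ?mul0e//.
  by apply: subset_measure0 N0 => //; exact: measurableI.
- move=> x /= Sx; have [Bx|] := pselect (B x); last by right.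
  by left; apply: BSN => /= /(_ Bx).
Qed.

End restriction.

(** * The mixture identity for the target, integrated and then pointwise *)

Section mixture_identity.
Context (R : realType) (A : pointedFinType)
  (TX TW Taux : completePseudoMetricType R) (M : max_arm_model A TX TW).
Implicit Types P : probability (borel TX * (discrete_space A * borel TW))%type R.

Lemma F_B_mixture_Psi f (l : {i01 R}) P0 P1 P2 :
  max_arm_structure M -> F_B M Taux f ->
  laws M P0 -> laws M P1 -> laws M P2 ->
  same_law (marginal P1) (marginal P0) ->
  same_law (marginal P2) (marginal P0) ->
  {ae marginal P0, forall x,
    [/\ mixture l%:num (cond M P1 x) (cond M P2 x) (cond M P0 x),
        eta2 M P1 x = eta2 M P0 x /\ kappa M P1 x = kappa M P0 x &
        eta2 M P2 x = eta2 M P0 x /\ kappa M P2 x = kappa M P0 x]} ->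
  Psi M P0 = (l%:num%:E * Psi M P1 + (1 - l%:num)%:E * Psi M P2)%E.
Proof.
move=> [[_ _ condM] _ _] [_ fM] MP0 MP1 MP2 P10 P20 mixP.
(* Unbiasedness holds for every measurable auxiliary map, so a constant one serves for all three
   laws. *)
pose w (x : borel TX) : borel Taux := point.
have mw : measurable_fun setT w by exact: measurable_cst.
have unbiased P : laws M P -> same_law (marginal P) (marginal P0) ->
    {ae marginal P0, forall x, eta2 M P x = eta2 M P0 x /\
      kappa M P x = kappa M P0 x} ->
    P.-integrable setT (EFin \o plug_in M f P0 P0 w) /\
    (\int[P]_z (plug_in M f P0 P0 w z)%:E = Psi M P)%E.
  move=> MP PP0 eqP.
  have eta2P : {ae marginal P, forall x, eta2 M P0 x = eta2 M P x}.
    by apply: (same_law_ae (same_law_sym PP0)); apply: filterS eqP => x [->].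
  (* Sampling is from [P] while the primary nuisances are those of [P0]: they may differ in [eta1]
     only, which is the case allowed by the agreement of [eta2]. *)
  have [iF IF] := fM _ _ _ MP MP0 mw (or_introl eta2P).
  (* Supplies measurability of the integrand at [P0], which almost everywhere equality alone would
     not transfer. *)
  have [iF0 _] := fM _ _ _ MP0 MP0 mw (or_introl (aeW _ (fun=> erefl))).
  have FF0 : {ae P, forall z, (EFin \o plug_in M f P P0 w) z =
      (EFin \o plug_in M f P0 P0 w) z}.
    have : {ae marginal P, forall x, kappa M P x = kappa M P0 x}.
      by apply: (same_law_ae (same_law_sym PP0)); apply: filterS eqP => x [].
    by move/marginal_ae; apply: filterS => z kz; rewrite /plug_in/= kz.
  have mF0 := measurable_int _ iF0.
  split; first exact: ae_eq_integrable FF0 iF.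
  rewrite -IF; apply: ae_eq_integral => //; first exact: measurable_int iF.
  by apply: filterS FF0 => z zE _.
have [_ <-] := unbiased _ MP0 (fun _ _ => erefl) (aeW _ (fun=> conj erefl erefl)).
have [i1 <-] := unbiased _ MP1 P10 (filterS (fun x '(And3 _ e _) => e) mixP).
have [i2 <-] := unbiased _ MP2 P20 (filterS (fun x '(And3 _ _ e) => e) mixP).
have l01 : 0 <= l%:num <= 1 by rewrite ge0 le1.
apply: (integral_mixture l01) i1 i2.
apply: (mixture_joint (condM _ MP0) (condM _ MP1) (condM _ MP2)) => //.
by apply: filterS mixP => x [].
Qed.

(** If the identity failed with a given sign on a subset of [B] of positive mass, conditioning the
    three laws on that subset would contradict the integrated identity. *)
Lemma F_B_mixture_psi f (l : {i01 R}) P0 P1 P2 (B : set (borel TX)) :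
  max_arm_structure M -> restriction_condition M -> F_B M Taux f ->
  laws M P0 -> laws M P1 -> laws M P2 ->
  same_law (marginal P1) (marginal P0) ->
  same_law (marginal P2) (marginal P0) ->
  measurable B ->
  {ae marginal P0, forall x, B x ->
    [/\ mixture l%:num (cond M P1 x) (cond M P2 x) (cond M P0 x),
        eta2 M P1 x = eta2 M P0 x /\ kappa M P1 x = kappa M P0 x &
        eta2 M P2 x = eta2 M P0 x /\ kappa M P2 x = kappa M P0 x]} ->
  {ae marginal P0, forall x, B x -> psi M x (u_of M P0 x) =
    l%:num * psi M x (u_of M P1 x) + (1 - l%:num) * psi M x (u_of M P2 x)}.
Proof.
move=> structM restrM fM MP0 MP1 MP2 P10 P20 mB mixP.
have [_ lawsM _] := structM.
pose ps P x := psi M x (u_of M P x).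
pose h (Q0 Q1 Q2 : probability (borel TX * (discrete_space A * borel TW))%type R)
  (s : R) x := s * (ps Q0 x - (l%:num * ps Q1 x + (1 - l%:num) * ps Q2 x)).
have mps P : laws M P -> measurable_fun setT (ps P).
  by move=> /lawsM[_ _ _ /(measurable_int _)/measurable_EFinP].
have mh Q0 Q1 Q2 s : laws M Q0 -> laws M Q1 -> laws M Q2 ->
    measurable_fun setT (h Q0 Q1 Q2 s).
  move=> MQ0 MQ1 MQ2; apply: measurable_funM => //.
  apply: measurable_funB; first exact: mps.
  by apply: measurable_funD; apply: measurable_funM => //; exact: mps.
(* [h] is the defect of the identity times [s]; the values 1 and -1 of [s] treat its two signs. *)
suff hs s : (marginal P0).-negligible (B `&` [set x | 0 < h P0 P1 P2 s x]).
  have := negligibleU (hs 1) (hs (-1)); apply: negligibleS => x /= /not_implyP[Bx].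
  rewrite /h mul1r mulN1r oppr_gt0 subr_gt0 subr_lt0 => /eqP; rewrite neq_lt.
  by case/orP => ?; [right|left].
set B' := B `&` _.
have mB' : measurable B'.
  apply: measurableI => //; rewrite -[X in measurable X]setTI.
  rewrite (_ : [set x | _] = h P0 P1 P2 s @^-1` `]0, +oo[%classic); last first.
    by apply/seteqP; split => x /=; rewrite in_itv/= andbT.
  exact: mh.
apply/negligibleP => //; apply: contrapT => /eqP; rewrite -measure_gt0 => B'0.
have marg P : same_law (marginal P) (marginal P0) ->
    (0 < marginal P B')%E by move=> ->.
(* The three laws share their marginal, so conditioning them on [B'] leaves the marginals equal, and
   it keeps the kernels and nuisance values on [B']. *)
have [P0' [MP0' margP0' condP0' etaP0']] := restrM _ _ MP0 mB' B'0.
have [P1' [MP1' margP1' condP1' etaP1']] := restrM _ _ MP1 mB' (marg _ P10).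
have [P2' [MP2' margP2' condP2' etaP2']] := restrM _ _ MP2 mB' (marg _ P20).
have P10' : same_law (marginal P1') (marginal P0').
  by move=> E mE; rewrite margP1'// margP0'// !P10//; exact: measurableI.
have P20' : same_law (marginal P2') (marginal P0').
  by move=> E mE; rewrite margP2'// margP0'// !P20//; exact: measurableI.
have aeB' S : {ae marginal P0, forall x, B' x -> S x} ->
    {ae marginal P0', forall x, S x} by exact: restricted_ae.
have {}condP1' := same_law_ae P10' condP1'.
have {}condP2' := same_law_ae P20' condP2'.
have {}etaP0' := aeB' _ etaP0'.
have {}etaP1' := aeB' _ (same_law_ae P10 etaP1').
have {}etaP2' := aeB' _ (same_law_ae P20 etaP2').
have mixP' : {ae marginal P0', forall x,
    [/\ mixture l%:num (cond M P1' x) (cond M P2' x) (cond M P0' x),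
        eta2 M P1' x = eta2 M P0' x /\ kappa M P1' x = kappa M P0' x &
        eta2 M P2' x = eta2 M P0' x /\ kappa M P2' x = kappa M P0' x]}.
  have : {ae marginal P0', forall x,
    [/\ mixture l%:num (cond M P1 x) (cond M P2 x) (cond M P0 x),
        eta2 M P1 x = eta2 M P0 x /\ kappa M P1 x = kappa M P0 x &
        eta2 M P2 x = eta2 M P0 x /\ kappa M P2 x = kappa M P0 x]}.
    by apply: aeB'; apply: filterS mixP => x mixx [Bx _]; exact: mixx.
  apply: filterS3 (filterI (filterI condP0' etaP0') (filterI condP1' etaP1'))
    (filterI condP2' etaP2') => x [[c0 [_ e0 k0]] [c1 [_ e1 k1]]] [c2 [_ e2 k2]].
  move=> [mixx [e10 k10] [e20 k20]]; split.
  - by apply: mixture_same_law mixx; exact: same_law_sym.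
  - by rewrite e1 k1 e0 k0.
  - by rewrite e2 k2 e0 k0.
have := F_B_mixture_Psi structM fM MP0' MP1' MP2' P10' P20' mixP'.
rewrite /Psi (same_law_integral _ _ P10') (same_law_integral _ _ P20').
pose nu := marginal P0'.
have ips P : laws M P -> same_law (marginal P) nu ->
    nu.-integrable setT (fun x => (ps P x)%:E).
  by move=> /lawsM[_ _ _ iP] Pnu; exact: same_law_integrable Pnu iP.
have i0 := ips _ MP0' (fun _ _ => erefl).
have i1 := ips _ MP1' P10'; have i2 := ips _ MP2' P20'.
have i1l : nu.-integrable setT (fun x => l%:num%:E * (ps P1' x)%:E)%E.
  exact: integrableZl.
have i2l : nu.-integrable setT (fun x => (1 - l%:num)%:E * (ps P2' x)%:E)%E.
  exact: integrableZl.
have i12 := integrableD measurableT i1l i2l.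
have i012 := integrableB measurableT i0 i12.
move=> PsiE.
have hE x : (h P0' P1' P2' s x)%:E = (s%:E * ((ps P0' x)%:E -
    (l%:num%:E * (ps P1' x)%:E + (1 - l%:num)%:E * (ps P2' x)%:E)))%E.
  by rewrite /h EFinM EFinB EFinD !EFinM.
have nu0 : (0 < marginal P0' setT)%E by rewrite probability_setT lte01.
(* Under the conditioned marginal the defect is positive almost everywhere, whereas [PsiE] makes its
   integral zero. *)
apply: (@ae_gt0_integral_neq0 _ _ _ nu (h P0' P1' P2' s) nu0).
- by apply: eq_integrable (integrableZl measurableT s i012).
- have h0 : {ae nu, forall x, 0 < h P0 P1 P2 s x} by apply: aeB'; apply: aeW => x [].
  apply: filterS3 (filterI etaP0' etaP1') etaP2' h0.
  move=> x [[+ _ _] [+ _ _]] [+ _ _].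
  by rewrite /h /ps /eta1 => -> -> ->.
- under eq_integral do rewrite hE.
  rewrite integralZl// integralB// integralD// !integralZl//.
  by rewrite -PsiE subee ?mule0//; exact: integrable_fin_num.
Qed.

End mixture_identity.

(** * Arm probabilities and arm means under mixtures *)

Section arm_laws.
Context (R : realType) (A : pointedFinType) (TW : completePseudoMetricType R).
Implicit Types Q : pprobability (discrete_space A * borel TW)%type R.

Lemma arm_prob_same_law Q Q' a : same_law Q Q' -> arm_prob Q a = arm_prob Q' a.
Proof. by move=> QQ'; rewrite /arm_prob QQ'//; exact: measurable_arm. Qed.

Lemma arm_law_same_law Q Q' a : same_law Q Q' ->
  same_law (arm_law Q a) (arm_law Q' a).
Proof.
move=> QQ' B mB; rewrite /arm_law (arm_prob_same_law _ QQ') QQ'//.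
exact: measurable_arm.
Qed.

Lemma has_arm_mean_same_law Q Q' a h r : same_law Q Q' ->
  has_arm_mean Q a h r -> has_arm_mean Q' a h r.
Proof.
move=> /(@arm_law_same_law _ _ a) QQ' [ih Ih]; split.
  exact: same_law_integrable ih.
by rewrite -(same_law_integral _ _ QQ').
Qed.

Lemma has_arm_mean_unique Q a h r r' :
  has_arm_mean Q a h r -> has_arm_mean Q a h r' -> r = r'.
Proof. by move=> [_ +] [_ +] => -> []. Qed.

Lemma arm_prob_mixture (l : R) Q1 Q2 Q a : mixture l Q1 Q2 Q ->
  arm_prob Q1 a = arm_prob Q2 a -> arm_prob Q a = arm_prob Q2 a.
Proof.
move=> mixQ Q12; have ma := @measurable_arm R A TW a _ measurableT.
have fin Q' : Q' (arm a setT) \is a fin_num by exact: fin_num_measure.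
rewrite {1}/arm_prob mixQ// -(fineK (fin Q1)) -(fineK (fin Q2)).
rewrite -/(arm_prob Q1 a) -/(arm_prob Q2 a) Q12 -!EFinM -EFinD/=.
by ring.
Qed.

(** Conditioning on an arm would in general reweight the components by their arm probabilities. As
    these agree, the arm law of the mixture is the mixture of the arm laws with the same weight
    [l]. *)
Lemma arm_mean_mixture (l : {i01 R}) Q1 Q2 Q a h r1 r2 r :
  mixture l%:num Q1 Q2 Q -> arm_prob Q1 a = arm_prob Q2 a ->
  has_arm_mean Q1 a h r1 -> has_arm_mean Q2 a h r2 -> has_arm_mean Q a h r ->
  r = l%:num * r1 + (1 - l%:num) * r2.
Proof.
move=> mixQ Q12 [i1 I1] [i2 I2] [_ I].
have mixa : mixture l%:num (arm_law Q1 a) (arm_law Q2 a) (arm_law Q a).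
  move=> B mB; rewrite /arm_law (arm_prob_mixture mixQ Q12) Q12.
  rewrite mixQ; last exact: measurable_arm.
  by rewrite ge0_muleDr ?mule_ge0// ?lee_fin ?subr_ge0// !muleA
    [X in (X * _ + _)%E]muleC [X in (_ + X * _)%E]muleC.
have l01 : 0 <= l%:num <= 1 by rewrite ge0 le1.
have := integral_mixture l01 mixa i1 i2.
by rewrite I I1 I2 -!EFinM -EFinD => -[].
Qed.

End arm_laws.

(** * Measurability and negligibility tools *)

Section vectors.
Context (R : realType) (A : Type).

Lemma measurable_fun_coordinate (a : A) :
  measurable_fun setT (fun u : vect R A => u a).
Proof.
move=> _ B mB; rewrite setTI; apply: sub_sigma_algebra.
by exists a, B.
Qed.

Lemma measurable_fun_vect d (T : measurableType d) (f : T -> vect R A) :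
  (forall a, measurable_fun setT (fun x => f x a)) -> measurable_fun setT f.
Proof.
move=> mf; apply: (measurability (@cylinders R A : set (set (vect R A)))) => //.
by move=> _ [_ [a [B [mB ->]]] <-]; exact: (mf a measurableT B mB).
Qed.

End vectors.

Section finite_quantifiers.
Context (I : finType) d (T : measurableType d).

Lemma measurable_forall (S : I -> set T) : (forall i, measurable (S i)) ->
  measurable [set x | forall i, S i x].
Proof.
move=> mS; rewrite (_ : [set x | _] = \bigcap_(i in setT) S i).
  by apply: fin_bigcap_measurable => // i _; exact: mS.
by apply/seteqP; split => x Sx i //; exact: Sx.
Qed.

End finite_quantifiers.

Section comparisons.
Context (R : realType) d (T : measurableType d) (f g : T -> R).
Context (mf : measurable_fun setT f) (mg : measurable_fun setT g).

Lemma measurable_lt_set : measurable [set x | f x < g x].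
Proof.
rewrite (_ : [set x | _] = setT `&` (fun x => f x < g x) @^-1` [set true]).
  exact: (measurable_fun_ltr mf mg).
by rewrite setTI; apply/seteqP; split.
Qed.

Lemma measurable_eq_set : measurable [set x | f x = g x].
Proof.
rewrite (_ : [set x | _] = setT `&` (fun x => f x == g x) @^-1` [set true]).
  exact: (measurable_fun_eqr mf mg).
by rewrite setTI; apply/seteqP; split => x /= /eqP.
Qed.

End comparisons.

Lemma negligible_countable_cover (R : realType) d (T : measurableType d)
    (mu : {measure set T -> \bar R}) (I : countType) (E : I -> set T) (S : set T) :
  (forall i, mu.-negligible (E i)) -> S `<=` [set x | exists i, E i x] ->
  mu.-negligible S.
Proof.
move=> nE SE; pose F n := if unpickle n is Some i then E i else set0.
have : mu.-negligible (\bigcup_n F n).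
  apply: negligible_bigcup => n; rewrite /F; case: unpickle => // .
  exact: negligible_set0.
apply: negligibleS => x /SE[i Eix]; exists (pickle i) => //.
by rewrite /F pickleK.
Qed.

(** * Points with a unique active arm *)

Section active_arms.
Context (R : realType) (A : pointedFinType)
  (TX TW : completePseudoMetricType R) (M : max_arm_model A TX TW).

Lemma active_arms1P (x : borel TX) (u : vect R A) (a : A) :
  active_arms M x u = [set a]%SET <->
  forall b, b != a -> gain M x b (u b) < gain M x a (u a).
Proof.
split=> [ua b ba|ua].
  have : a \in active_arms M x u by rewrite ua finset.in_set1.
  have : b \notin active_arms M x u by rewrite ua finset.in_set1.
  rewrite !finset.inE => /forallPn[c]; rewrite -ltNge => bc /forallP/(_ c).
  exact: lt_le_trans.
apply/finset.setP => b; rewrite !finset.inE.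
have [->|ba] := eqVneq b a.
  apply/forallP => c; have [->//|ca] := eqVneq c a.
  by rewrite ltW// ua.
by apply/forallPn; exists a; rewrite -ltNge ua.
Qed.

Lemma psi_active1 (x : borel TX) (u : vect R A) (a : A) :
  active_arms M x u = [set a]%SET -> psi M x u = gain M x a (u a).
Proof.
move=> /active_arms1P ua; rewrite /psi.
rewrite (_ : \big[maxe/-oo%E]_b _ = (gain M x a (u a))%:E)//.
apply/eqP; rewrite eq_le; apply/andP; split; last exact: le_bigmax.
apply/bigmax_leP; split; first exact: leNye.
move=> b _; rewrite lee_fin; have [->//|ba] := eqVneq b a.
by rewrite ltW// ua.
Qed.

End active_arms.

(** * Gluing of shifted and mixed kernels, and the affine identity for the gain *)

Section perturbed_laws.
Context (R : realType) (A : pointedFinType)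
  (TX TW Taux : completePseudoMetricType R) (M : max_arm_model A TX TW).
Context (structM : max_arm_structure M) (scoresM : identifying_scores M)
  (standM : standing_conditions M) (pertM : perturbation_conditions M).
Implicit Types P : probability (borel TX * (discrete_space A * borel TW))%type R.

(** The target mean [t] is fixed and the displacement varies with [x], so that the gain is compared
    at the same arguments for all [x]. *)
Definition to_mean P (a : A) (t : R) (x : borel TX) : vect R A :=
  single a (t - u_of M P x a).

Let shift_law P a t x := shifted M P x (to_mean P a t x).

Let mixed_law (l : {i01 R}) P1 P2 x :
    pprobability (discrete_space A * borel TW)%type R :=
  mixture_law l (cond M P1 x) (cond M P2 x).

Lemma measurable_cond P : laws M P -> measurable_fun setT (cond M P).
Proof. by case: structM => -[_ _ condM] _ _ /condM[]. Qed.

Lemma measurable_u_of P a : laws M P ->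
  measurable_fun setT (fun x => u_of M P x a).
Proof.
case: structM => _ lawsM _ /lawsM[mu _ _ _].
exact: measurableT_comp (measurable_fun_coordinate a) mu.
Qed.

Lemma measurable_to_mean P a t : laws M P -> measurable_fun setT (to_mean P a t).
Proof.
move=> MP; apply: measurable_fun_vect => b; rewrite /to_mean /single.
by case: eqP => _ //; apply: measurable_funB => //; exact: measurable_u_of.
Qed.

(** The gain is measurable only for the trace on [U0]. Since the arm means lie in [U0], the preimage
    of a trace set along [i] is the preimage of the measurable set [C]. *)
Lemma measurable_gain P a : laws M P ->
  measurable_fun setT (fun x => gain M x a (u_of M P x a)).
Proof.
case: structM => -[mgain _ _] lawsM _ MP _ B mB.
have [_ U0u _ _] := lawsM _ MP.
have [C mC gC] := mgain _ mB.
pose i (x : borel TX) := (x, a : discrete_space A, u_of M P x a).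
have mi : measurable_fun setT i.
  apply: measurable_fun_pair; last exact: measurable_u_of.
  exact: measurable_fun_pair.
rewrite (_ : _ `&` _ = setT `&` i @^-1` C); first exact: mi.
rewrite !setTI; apply/seteqP; split => x /= Hx.
  suff [] : ([set z | U0 M z.2] `&` C) (i x) by [].
  by rewrite -gC; split => //=; exact: U0u.
suff [] : ([set z : (borel TX * discrete_space A * R)%type | U0 M z.2] `&`
  (fun z => gain M z.1.1 z.1.2 z.2) @^-1` B) (i x) by [].
by rewrite gC; split => //=; exact: U0u.
Qed.

Lemma measurable_arm_prob P a : laws M P ->
  measurable_fun setT (fun x => arm_prob (cond M P x) a).
Proof.
move=> /measurable_cond mP; apply: measurableT_comp => //.
by apply: measurable_fun_evaluation => //; exact: measurable_arm.
Qed.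

(** Where the wanted direction is inadmissible it is replaced by 0, which gives a measurable
    selection of directions. Localization at level [m] keeps the shifted kernel wherever its cost is
    at most [m]. *)
Lemma shifted_law P a t m : laws M P -> exists P', [/\ laws M P',
  same_law (marginal P') (marginal P) &
  {ae marginal P, forall x, directions M P (x, to_mean P a t x) ->
    cost M (x, shift_law P a t x) <= m%:R ->
    same_law (cond M P' x) (shift_law P a t x)}].
Proof.
move=> MP; have [_ [mD D0 _ _] [_ _ _ glueX3]] := pertM MP.
pose F := [set x | directions M P (x, to_mean P a t x)].
have mF : measurable F.
  have mi : measurable_fun setT (fun x : borel TX => (x, to_mean P a t x)).
    by apply: measurable_fun_pair => //; exact: measurable_to_mean.
  by rewrite -[F]setTI; exact: mi.
pose dir x : vect R A := if x \in F then to_mean P a t x else fun=> 0.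
have mdir : measurable_fun setT dir.
  apply: measurable_fun_ifT.
  - by apply: (measurable_fun_bool true); rewrite setTI preimage_mem_true.
  - exact: measurable_to_mean.
  - by apply: measurable_fun_vect => b; exact: measurable_cst.
have Ddir : {ae marginal P, forall x, directions M P (x, dir x)}.
  apply: filterS D0 => x D0x; rewrite /dir.
  by case: ifPn => [/set_mem|].
have [_ /(_ m)[P' [[MP' margP' condP'] _]]] :=
  glueX3 _ (universally_measurable_fun_measurable mdir) Ddir.
exists P'; split => //; apply: filterS condP' => x + Dx cx.
by rewrite /cost_localized /dir mem_set// cx.
Qed.

(** The kernel of [P] replaces the mixture outside the graph; the result is an admissible selection,
    which glues after localization at level [m]. *)
Lemma mixed_law_glued (l : {i01 R}) P P1 P2 m : laws M P -> laws M P1 ->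
  laws M P2 -> exists P', [/\ laws M P',
  same_law (marginal P') (marginal P) &
  {ae marginal P, forall x, graph M (x, mixed_law l P1 P2 x) ->
    cost M (x, mixed_law l P1 P2 x) <= m%:R ->
    same_law (cond M P' x) (mixed_law l P1 P2 x)}].
Proof.
move=> MP MP1 MP2; have [mG _ [_ _ _ graphP glueK] _] := standM.
pose G := [set x | graph M (x, mixed_law l P1 P2 x)].
have mmix : measurable_fun setT (mixed_law l P1 P2).
  by apply: measurable_fun_mixture_law; exact: measurable_cond.
have mG' : measurable G.
  have mi : measurable_fun setT (fun x : borel TX => (x, mixed_law l P1 P2 x)).
    exact: measurable_fun_pair.
  by rewrite -[G]setTI; exact: mi.
pose K x := if x \in G then mixed_law l P1 P2 x else cond M P x.
have selK : selection P (graph M) K.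
  split.
    apply: universally_measurable_fun_measurable; apply: measurable_fun_ifT => //.
    - by apply: (measurable_fun_bool true); rewrite setTI preimage_mem_true.
    - exact: measurable_cond.
  apply: filterS (graphP _ MP).1 => x Gx; rewrite /K.
  by case: ifPn => [/set_mem|].
have [_ /(_ m)[P' [[MP' margP' condP'] _]]] := glueK _ _ MP selK.
exists P'; split => //; apply: filterS condP' => x + Gx cx.
by rewrite /cost_localized /K mem_set// cx.
Qed.

Definition retargeted P (a : A) (t : R) (x : borel TX) : vect R A :=
  fun b => if b == a then t else u_of M P x b.

(** Gluing controls the kernel only. The identifying scores recover the arm means from it, and
    [kappa] is recovered through its local form. *)
Lemma shifted_law_nuisance P P' a t m : laws M P -> laws M P' ->
  same_law (marginal P') (marginal P) ->
  {ae marginal P, forall x, directions M P (x, to_mean P a t x) ->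
    cost M (x, shift_law P a t x) <= m%:R ->
    same_law (cond M P' x) (shift_law P a t x)} ->
  {ae marginal P, forall x, directions M P (x, to_mean P a t x) ->
    cost M (x, shift_law P a t x) <= m%:R ->
    [/\ same_law (cond M P' x) (shift_law P a t x),
        forall b, arm_prob (cond M P' x) b = arm_prob (cond M P x) b,
        u_of M P' x = retargeted P a t x &
        kappa M P' x = kappa M P x]}.
Proof.
move=> MP MP' margP' condP'.
have [mG _ [_ _ _ graphM _] [_ _ mkappa locM]] := standM.
have [_ _ [X3 _ _ _]] := pertM MP.
have graphP' := same_law_ae margP' (graphM _ MP').1.
have locP' := same_law_ae margP' (locM _ MP').
apply: filterS2 (filterI condP' X3) (filterI graphP' locP').
move=> x [cx X3x] [gx [_ _ kx]] Dx mx.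
have {}cx := cx Dx mx; have [_ probx meanx graphx [_ kappax]] := X3x _ Dx.
split => //.
- by move=> b; rewrite (arm_prob_same_law _ cx) probx.
- apply/funext => b; have := scoresM.2 P' x b MP'.
  move=> /(has_arm_mean_same_law cx)/has_arm_mean_unique/(_ (meanx b)) ->.
  rewrite /retargeted /to_mean /single; case: eqP => [->|_]; last by rewrite addr0.
  by rewrite addrC subrK.
- rewrite kx -kappax.
  have mset1 : measurable ([set kappa_loc M (x, cond M P' x)] :
      set (discrete_space {set A})) by exact: sub_sigma_algebra.
  (* A level set of [kappa_loc] in the graph is measurable, so [kappa_loc] does not distinguish
     kernels with the same law. *)
  by have [_ /= ->] := measurable_saturated (mkappa mG _ mset1) cx (conj gx erefl).
Qed.

(** [P1] and [P2] shift the mean of arm [a] to [t1] and [t2], and [P0] glues the mixture of their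
    kernels. [P3] is shifted directly to [t0]; comparing arm means with [P3] shows that [a] stays
    the unique active arm under [P0]. *)
Lemma affine_gain_ae f P (a : A) (t1 t2 : R) (l : {i01 R}) m (S : set (borel TX)) :
  let t0 := l%:num * t1 + (1 - l%:num) * t2 in
  F_B M Taux f -> laws M P ->
  (forall x, S x -> kappa M P x = [set a]%SET) ->
  (forall x t, S x -> [\/ t = t0, t = t1 | t = t2] ->
    directions M P (x, to_mean P a t x) /\
    cost M (x, shift_law P a t x) <= m%:R) ->
  (forall x (Q : pprobability (discrete_space A * borel TW)%type R), S x ->
    mixture l%:num (shift_law P a t1 x) (shift_law P a t2 x) Q ->
    graph M (x, Q)) ->
  {ae marginal P, forall x, S x -> gain M x a t0 =
    l%:num * gain M x a t1 + (1 - l%:num) * gain M x a t2}.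
Proof.
move=> t0 fM MP activeS costS graphS.
have [mG restrM [mcost _ _ _ _] _] := standM.
have shiftP t : [\/ t = t0, t = t1 | t = t2] -> exists P', [/\ laws M P',
    same_law (marginal P') (marginal P) &
    {ae marginal P, forall x, S x ->
    [/\ same_law (cond M P' x) (shift_law P a t x),
        forall b, arm_prob (cond M P' x) b = arm_prob (cond M P x) b,
        u_of M P' x = retargeted P a t x &
        kappa M P' x = [set a]%SET]}].
  move=> t012; have [P' [MP' margP' condP']] := shifted_law a t m MP.
  exists P'; split => //.
  apply: filterS (shifted_law_nuisance MP MP' margP' condP') => x + Sx.
  by have [Dx cx] := costS _ _ Sx t012; rewrite activeS//; exact.
have [P1 [MP1 margP1 condP1]] := shiftP t1 (Or32 _ _ erefl).
have [P2 [MP2 margP2 condP2]] := shiftP t2 (Or33 _ _ erefl).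
have [P3 [MP3 margP3 condP3]] := shiftP t0 (Or31 _ _ erefl).
pose V := [set x | gain M x a t0 <>
  l%:num * gain M x a t1 + (1 - l%:num) * gain M x a t2].
pose mixed := mixed_law l P1 P2.
pose C n := [set x | cost M (x, mixed x) <= n%:R].
(* The bound [m] concerns the shifted kernels; the cost of the mixture is merely finite, so the
   points are exhausted by its sublevel sets. *)
suff negC n : (marginal P).-negligible ((S `&` V) `&` C n).
  apply: (negligible_countable_cover negC) => x /= /not_implyP[Sx Vx].
  exists (Num.bound `|cost M (x, mixed x)|); split => //.
  by rewrite /C/= (le_trans (ler_norm _))// ltW// archi_boundP.
have [P0 [MP0 margP0 condP0]] := mixed_law_glued l n MP MP1 MP2.
pose same_arm_probs Q := [set x | forall b,
  arm_prob (cond M Q x) b = arm_prob (cond M P0 x) b].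
pose unique_arm Q := [set x | forall b, b != a ->
  gain M x b (u_of M Q x b) < gain M x a (u_of M Q x a)].
(* [S] may fail to be measurable. [B] collects measurable conditions that suffice for the pointwise
   identity and hold at almost every point of [S] in [V] and [C n]. *)
pose B := [set x | graph M (x, mixed x) /\ C n x] `&`
  (same_arm_probs P1 `&` same_arm_probs P2) `&`
  (unique_arm P0 `&` unique_arm P1 `&` unique_arm P2).
have mB : measurable B.
  have mprobs Q : laws M Q -> measurable (same_arm_probs Q).
    move=> MQ; apply: measurable_forall => b.
    by apply: measurable_eq_set; exact: measurable_arm_prob.
  have munique Q : laws M Q -> measurable (unique_arm Q).
    move=> MQ; apply: measurable_forall => b.
    have [->|ba] := eqVneq b a.
      by rewrite [X in measurable X](_ : _ = setT)//; apply/seteqP; split.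
    rewrite [X in measurable X](_ : _ =
        [set x | gain M x b (u_of M Q x b) < gain M x a (u_of M Q x a)]).
      by apply: measurable_lt_set; exact: measurable_gain.
    by apply/seteqP; split => x //=; exact.
  apply: measurableI; apply: measurableI; [|by apply: measurableI; exact: mprobs
    |by apply: measurableI; exact: munique|exact: munique].
  have mi : measurable_fun setT (fun x : borel TX => (x, mixed x)).
    apply: measurable_fun_pair => //.
    by apply: measurable_fun_mixture_law; exact: measurable_cond.
  have mGn : measurable (graph M `&` cost M @^-1` `]-oo, n%:R]%classic).
    exact: mcost.
  rewrite -[X in measurable X]setTI.
  suff -> : [set x | graph M (x, mixed x) /\ C n x] = (fun x => (x, mixed x)) @^-1`
      (graph M `&` cost M @^-1` `]-oo, n%:R]%classic) by exact: mi.
  by apply/seteqP; split => x; rewrite /C /= in_itv.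
have margP10 : same_law (marginal P1) (marginal P0).
  exact: same_law_trans margP1 (same_law_sym margP0).
have margP20 : same_law (marginal P2) (marginal P0).
  exact: same_law_trans margP2 (same_law_sym margP0).
have affB : {ae marginal P, forall x, B x -> psi M x (u_of M P0 x) =
    l%:num * psi M x (u_of M P1 x) + (1 - l%:num) * psi M x (u_of M P2 x)}.
  apply: (same_law_ae margP0).
  apply: (F_B_mixture_psi structM restrM fM MP0 MP1 MP2 margP10 margP20 mB).
  apply: (same_law_ae (same_law_sym margP0)).
  apply: filterS condP0 => x cx [[[Gx Cx] [e1 e2]] [[k0 k1] k2]].
  have kappaE Q : unique_arm Q x -> kappa M Q x = [set a]%SET.
    by move=> ?; apply/active_arms1P.
  split.
  - move=> D mD; rewrite cx//; exact: mixture_lawE.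
  - by split; [apply/funext => b; exact: e1|rewrite !kappaE].
  - by split; [apply/funext => b; exact: e2|rewrite !kappaE].
suff : {ae marginal P, forall x, ~ ((S `&` V) `&` C n) x}.
  by apply: negligibleS => x SVC /=; apply.
apply: filterS3 (filterI affB condP0) (filterI condP1 condP2) condP3.
move=> x [aff c0] [c1 c2] c3 [[Sx Vx] Cx].
have [{}c1 p1 u1 k1] := c1 Sx; have [{}c2 p2 u2 k2] := c2 Sx.
have [{}c3 p3 u3 k3] := c3 Sx.
have mixx : mixture l%:num (cond M P1 x) (cond M P2 x) (mixed x).
  by move=> D mD; exact: mixture_lawE.
have Gx : graph M (x, mixed x).
  by apply: graphS => //; apply: mixture_same_law mixx.
have {}c0 := c0 Gx Cx.
have mix0 := mixture_same_law (fun _ _ => erefl) (fun _ _ => erefl)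
  (same_law_sym c0) mixx.
have p12 b : arm_prob (cond M P1 x) b = arm_prob (cond M P2 x) b.
  by rewrite p1 p2.
have p0 b : arm_prob (cond M P0 x) b = arm_prob (cond M P x) b.
  by rewrite (arm_prob_mixture mix0)// p2.
(* Arm [a] has mean [t0] under both laws; every other mean is the same in the two components, hence
   also in their mixture. *)
have u0 : u_of M P0 x = u_of M P3 x.
  apply/funext => b; have mean Q := scoresM.2 Q x b.
  rewrite (arm_mean_mixture mix0 (p12 b) (mean _ MP1) (mean _ MP2) (mean _ MP0)).
  rewrite u1 u2 u3 /retargeted; case: eqP => // _.
  by ring.
have k0 : kappa M P0 x = [set a]%SET by rewrite /kappa u0.
apply: Vx.
have := aff; rewrite (psi_active1 k0) (psi_active1 k1) (psi_active1 k2).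
rewrite u0 u1 u2 u3 /retargeted eqxx; apply.
by split; [split => //; split => b; rewrite p0|split; [split|]; apply/active_arms1P].
Qed.

End perturbed_laws.

(** * Countable covering of [X0] and emptiness of both classes *)

Theorem proposition5p13 (R : realType) (A : pointedFinType)
    (TX TW Taux : completePseudoMetricType R)
    (pTX : polish TX) (pTW : polish TW) (pTaux : polish Taux)
    (M : max_arm_model A TX TW)
    (structM : max_arm_structure M) (scoresM : identifying_scores M)
    (standM : standing_conditions M) (pertM : perturbation_conditions M)
    (Pach : set (probability (borel TX * (discrete_space A * borel TW))%type R))
    (Pach_laws : Pach `<=` laws M)
    (P : probability (borel TX * (discrete_space A * borel TW))%type R)
    (MP : laws M P)
    (X0 : set (borel TX)) (mX0 : measurable X0)
    (X0_gt0 : (0 < marginal P X0)%E)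
    (astar : borel TX -> A) (J : borel TX -> set R)
    (active : forall x, X0 x -> forall a, a != astar x ->
      gain M x a (u_of M P x a) <
      gain M x (astar x) (u_of M P x (astar x)))
    (J_interval : forall x, X0 x ->
      [/\ @convex_set R R^o (J x),
          exists m1 m2, [/\ J x m1, J x m2 & m1 != m2] &
          J x `<=` U0 M])
    (J_shift : forall x m, X0 x -> J x m ->
      let ast := astar x in
      let d := single ast (m - u_of M P x ast) in
      let Q := shifted M P x d in
      [/\ directions M P (x, d),
          has_arm_mean Q ast (score M ast) m,
          forall a, a != ast -> has_arm_mean Q a (score M a) (u_of M P x a),
          forall a, arm_prob Q a = arm_prob (cond M P x) a &
          eta2_loc M (x, Q) = eta2 M P x /\ kappa_loc M (x, Q) = kappa M P x])
    (J_mixture : forall x m1 m2 (l : R)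
        (Q' : pprobability (discrete_space A * borel TW)%type R), X0 x -> J x m1 -> J x m2 -> 0 <= l <= 1 ->
      let shift_to m :=
        shifted M P x (single (astar x) (m - u_of M P x (astar x))) in
      mixture l (shift_to m1) (shift_to m2) Q' -> graph M (x, Q'))
    (J_nonaffine : forall x, X0 x ->
      C1_on (J x) (gain M x (astar x)) /\
      ~ affine_on (J x) (gain M x (astar x))) :
  F_B M Taux = set0 /\ T_RL M Taux Pach = set0.
Proof.
suff FB0 : F_B M Taux = set0.
  split => //; apply/seteqP; split => // T [_ [f]].
  by rewrite FB0.
apply/seteqP; split => // f fM.
pose shift x t := shifted M P x (to_mean M P (astar x) t x).
pose tmix (p r l : rat) : R := ratr l * ratr p + (1 - ratr l) * ratr r.
(* The arm, the two targets, the weight and the cost bound range over countable types, and [J]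
   enters only through membership of the two targets. The sets [bad] cover [X0], so it suffices that
   each be negligible. *)
pose good a p r (l : rat) m := [set x | [/\ X0 x, astar x = a,
  J x (ratr p) /\ J x (ratr r) &
  forall t, [\/ t = tmix p r l, t = ratr p | t = ratr r] ->
    cost M (x, shift x t) <= m%:R]].
pose bad (i : A * rat * rat * rat * nat) := let: (a, p, r, l, m) := i in
  [set x : borel TX | [/\ 0 <= (ratr l : R) <= 1, good a p r l m x &
    gain M x a (tmix p r l) <>
      ratr l * gain M x a (ratr p) + (1 - ratr l) * gain M x a (ratr r)]].
suff nbad i : (marginal P).-negligible (bad i).
  have : (marginal P).-negligible X0.
    apply: (negligible_countable_cover nbad) => x Xx.
    have [cJ ndJ _] := J_interval x Xx; have [C1g naff] := J_nonaffine x Xx.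
    have [p [r [l [l01 Jp Jr viol]]]] := nonaffine_rational cJ ndJ C1g naff.
    pose c (t : R) : R := `|cost M (x, shift x t)|.
    have c0 t : 0 <= c t by exact: normr_ge0.
    (* A sum of absolute values bounds each of the three costs, so an integer above it is a common
       cost level. *)
    pose K := c (tmix p r l) + c (ratr p) + c (ratr r).
    have K0 : 0 <= K by rewrite /K !addr_ge0.
    exists (astar x, p, r, l, Num.bound K); split => //; split => // t tprl.
    apply: le_trans (ltW (archi_boundP K0)); apply: (@le_trans _ _ (c t)).
      exact: ler_norm.
    have := c0 (tmix p r l); have := c0 (ratr p); have := c0 (ratr r).
    by case: tprl => ->; rewrite /K; lra.
  by move=> /(measure_negligible mX0) X00; rewrite X00 ltxx in X0_gt0.
case: i => [[[[a p] r] l] m].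
have [/andP[l0 l1]|nl01] := boolP (0 <= (ratr l : R) <= 1); last first.
  by apply: negligibleS (negligible_set0 _) => x [l01]; rewrite l01 in nl01.
pose L := Itv01 l0 l1.
have aff := @affine_gain_ae _ _ _ _ Taux M structM scoresM standM pertM f P a
  (ratr p) (ratr r) L m (good a p r l m) fM MP.
suff : {ae marginal P, forall x, good a p r l m x -> gain M x a (tmix p r l) =
    ratr l * gain M x a (ratr p) + (1 - ratr l) * gain M x a (ratr r)}.
  by apply: negligibleS => x [_ gx viol] /= /(_ gx).
apply: aff.
- move=> x [Xx ax _ _]; apply/active_arms1P; rewrite -ax => b; exact: active.
- move=> x t [Xx ax [Jp Jr] cx] tprl.
  (* The mixed target lies in [J x] by convexity, so the direction towards it is admissible as
     well. *)
  have Jt : J x t.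
    case: tprl => -> //; have [cJ _ _] := J_interval x Xx.
    by have := cJ (ratr p) (ratr r) L; rewrite !inE => /(_ Jp Jr).
  split; last by have := cx t tprl; rewrite /shift ax.
  by rewrite -ax; have [] := J_shift x t Xx Jt.
- move=> x Q [Xx ax [Jp Jr] _]; rewrite -ax => mixQ.
  apply: (J_mixture x (ratr p) (ratr r) (ratr l) Q) => //.
  by rewrite l0 l1.
Qed.
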